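(* Let $\mathfrak{m}=(X_1,\dots,X_n)\subset R=K[X_1,\dots,X_n]$, regarded as a graded $R$-module. Then $$\operatorname{Hdepth}_1\mathfrak{m}=\operatorname{Hdepth}_n\mathfrak{m}=\operatorname{Stdepth}_n\mathfrak{m}=\lfloor (n+1)/2\rfloor.$$
   Context: $K$ is a field. Subscript $n$ refers to the multigrading ($\mathbb{Z}^n$-grading, $\deg X_i=e_i$), subscript $1$ to the standard grading ($\deg X_i=1$). A graded retract of $R$ is a graded $K$-subalgebra $S\subseteq R$ with a graded $K$-algebra epimorphism $\pi:R\to S$, $\pi|_S=\mathrm{id}$ (multigraded: generated by a subset of the indeterminates; standard graded: generated by a set of linear forms). A Stanley decomposition of $M$ is a finite family $(S_i,x_i)_{i\in I}$ with $x_i\in M$ homogeneous, $S_i$ a graded retract, $S_i\cap\operatorname{Ann}(x_i)=0$, $M=\bigoplus_iS_ix_i$ as graded $K$-vector spaces. A Hilbert decomposition is a finite family $(S_i,s_i)_{i\in I}$, $s_i$ degrees, $S_i$ graded retracts, with $M\cong\bigoplus_iS_i(-s_i)$ as graded $K$-vector spaces. The depth of a decomposition is $\min_i\dim S_i$; Stdepth (resp. Hdepth) is the maximal depth of a Stanley (resp. Hilbert) decomposition in the respective grading. *)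

(* Defs.v *)
From HB Require Import structures.
From mathcomp Require Import all_boot all_algebra.
From mathcomp Require Export mpoly.

Set Implicit Arguments.
Unset Strict Implicit.
Unset Printing Implicit Defensive.

Import GRing.Theory.
Local Open Scope ring_scope.

Section Defs.
Variables (K : fieldType) (n : nat).
Local Notation R := {mpoly K[n]}.

(* Standard grading: p is homogeneous of degree d (d : int); for d < 0 this forces p = 0. *)
Definition homog1 (d : int) (p : R) : Prop :=
  forall m, m \in msupp p -> (mdeg m)%:Z = d.

Definition homogn (a : 'I_n -> int) (p : R) : Prop :=
  forall m, m \in msupp p -> forall i, (m i)%:Z = a i.

Definition sub1 (d e : int) : int := d - e.
Definition subn_deg (a b : 'I_n -> int) : 'I_n -> int := fun i => a i - b i.

Section Generic.
Variable D : Type.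
Variable hom : D -> R -> Prop.
Variable sub : D -> D -> D.

Definition kalg_endo (f : R -> R) : Prop :=
  [/\ forall p q, f (p + q) = f p + f q,
      forall p q, f (p * q) = f p * f q,
      f 1 = 1 &
      forall (c : K) p, f (c *: p) = c *: f p].

(* graded retract: S is the image of a graded K-algebra endomorphism pi of R
   (i.e. a graded epimorphism R -> S) with pi|_S = id *)
Definition graded_retract (S : R -> Prop) : Prop :=
  exists pi : R -> R,
    [/\ kalg_endo pi,
        (forall d p, hom d p -> hom d (pi p)),
        (forall p, S (pi p)) &
        (forall s, S s -> pi s = s)].

(* Krull dimension of a subring S of R, via chains of prime ideals of S.
   Ideals of S are represented as subsets of R contained in S. *)
Definition ideal_of (S P : R -> Prop) : Prop :=
  [/\ forall p, P p -> S p,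
      P 0,
      (forall p q, P p -> P q -> P (p + q)) &
      (forall a p, S a -> P p -> P (a * p))].

Definition prime_of (S P : R -> Prop) : Prop :=
  [/\ ideal_of S P, ~ P 1 &
      forall a b, S a -> S b -> P (a * b) -> P a \/ P b].

Definition dim_ge (S : R -> Prop) (k : nat) : Prop :=
  exists P : nat -> R -> Prop,
    (forall i, (i <= k)%N -> prime_of S (P i)) /\
    (forall i, (i < k)%N ->
       (forall p, P i p -> P i.+1 p) /\ exists p, P i.+1 p /\ ~ P i p).

Definition stanley_dec (M : R -> Prop) (k : nat)
    (S : 'I_k -> R -> Prop) (x : 'I_k -> R) : Prop :=
  [/\ forall i, graded_retract (S i),
      forall i, M (x i) /\ exists d, hom d (x i),
      forall i s, S i s -> s * x i = 0 -> s = 0,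
      forall p, M p <-> exists t : {ffun 'I_k -> R},
                   (forall i, S i (t i)) /\ p = \sum_i t i * x i &
      forall t : {ffun 'I_k -> R}, (forall i, S i (t i)) ->
        \sum_i t i * x i = 0 -> forall i, t i * x i = 0].

(* Hilbert decomposition (S_i, s_i)_{i < k} of M: a graded K-linear isomorphism
   phi : (+)_i S_i(-s_i) -> M; elements of the external direct sum are tuples t
   with t_i in S_i, and the degree-d part consists of the t with t_i
   homogeneous of degree d - s_i in S_i. *)
Definition hilbert_dec (M : R -> Prop) (k : nat)
    (S : 'I_k -> R -> Prop) (s : 'I_k -> D) : Prop :=
  (forall i, graded_retract (S i)) /\
  exists phi : {ffun 'I_k -> R} -> R,
    [/\
        forall (c : K) (t u : {ffun 'I_k -> R}),
          (forall i, S i (t i)) -> (forall i, S i (u i)) ->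
          phi [ffun i => c *: t i + u i] = c *: phi t + phi u,
        forall t : {ffun 'I_k -> R}, (forall i, S i (t i)) -> M (phi t),
        forall t u : {ffun 'I_k -> R}, (forall i, S i (t i)) -> (forall i, S i (u i)) ->
          phi t = phi u -> t = u,
        forall p, M p -> exists t : {ffun 'I_k -> R}, (forall i, S i (t i)) /\ phi t = p &
        forall d (t : {ffun 'I_k -> R}), (forall i, S i (t i) /\ hom (sub d (s i)) (t i)) ->
          hom d (phi t)].

(* Hdepth M = q : some Hilbert decomposition has depth (= min_i dim S_i) >= q,
   and every Hilbert decomposition has depth <= q. *)
Definition is_Hdepth (M : R -> Prop) (q : nat) : Prop :=
  (exists k S s, hilbert_dec M (k := k) S s /\ forall i, dim_ge (S i) q) /\
  (forall k S s, hilbert_dec M (k := k) S s -> exists i, ~ dim_ge (S i) q.+1).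

Definition is_Stdepth (M : R -> Prop) (q : nat) : Prop :=
  (exists k S x, stanley_dec M (k := k) S x /\ forall i, dim_ge (S i) q) /\
  (forall k S x, stanley_dec M (k := k) S x -> exists i, ~ dim_ge (S i) q.+1).

End Generic.

Definition maxideal (p : R) : Prop :=
  exists c : 'I_n -> R, p = \sum_i c i * 'X_i.

End Defs.

(* Main.v *)
Require Import Defs.
From mathcomp Require Import all_boot all_algebra.
From mathcomp Require Import mpoly.
From mathcomp Require Import zify.
From Stdlib Require Import Classical.

(** Upper bound.  In a standard graded Hilbert decomposition exactly [n] of the
    summands sit in degree 1, and a summand whose retract has dimension at least
    [d] contributes at least [d] to degree 2; hence [n d <= n (n + 1) / 2].  That a
    retract of Krull dimension [d] contains [d] independent linear forms follows by
    lifting a chain of primes to algebraically independent elements and comparing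
    numbers of monomials.  Multigraded decompositions are special cases.

    Lower bound.  It suffices to partition the nonempty subsets of an odd cycle
    into intervals [[A, B]] with [B] large: the pieces [K[X_b : b in B] X^A] then
    decompose the maximal ideal.  Take [B] the complement of an independent set [E]
    of the cycle and [A] the set of points [p] with neither [p] nor its successor
    in [E]; a nonempty [C] lies in the interval of [E] iff [E] is the kernel of the
    successor digraph on the complement of [C], which exists and is unique. *)

Set Implicit Arguments.
Unset Strict Implicit.
Unset Printing Implicit Defensive.

Import GRing.Theory.
Local Open Scope ring_scope.

(** * Counting bounds for linearly and algebraically independent polynomials *)

Lemma leq_card_of_row_indep (K : fieldType) (V W : finType) (M : V -> W -> K) :
  (forall c : V -> K, (forall w, \sum_v c v * M v w = 0) -> forall v, c v = 0) ->
  (#|V| <= #|W|)%N.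
Proof.
move=> indM; pose A := \matrix_(i < #|V|, j < #|W|) M (enum_val i) (enum_val j).
have /eqP <- : \rank A == #|V|; last exact: rank_leq_col.
apply/inj_row_free => u uA0; apply/rowP => i; rewrite mxE.
rewrite -(enum_valK i); apply: (indM (fun v => u 0 (enum_rank v))) => w.
have /rowP/(_ (enum_rank w)) := uA0; rewrite !mxE => uA; rewrite -[RHS]uA.
rewrite (reindex (fun i : 'I_#|V| => enum_val i)) /=;
  last by apply: onW_bij; exact: enum_val_bij.
by apply: eq_bigr => j _; rewrite mxE enum_valK enum_rankK.
Qed.

Lemma leq_card_of_mpoly_indep (K : fieldType) (n : nat) (V : finType)
    (v : V -> {mpoly K[n]}) (ms : seq 'X_{1..n}) :
  (forall x m, m \in msupp (v x) -> m \in ms) ->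
  (forall c : V -> K, \sum_x c x *: v x = 0 -> forall x, c x = 0) ->
  (#|V| <= size ms)%N.
Proof.
move=> vms indv; rewrite -(card_ord (size ms)).
apply: (@leq_card_of_row_indep K V _ (fun x j => (v x)@_(tnth (in_tuple ms) j))).
move=> c c0; apply: indv; apply/mpolyP => m; rewrite mcoeff0 raddf_sum /=.
have [m_ms|mNms] := boolP (m \in ms).
  have [j ->] := seq_tnthP m_ms; rewrite -[RHS](c0 j).
  by apply: eq_bigr => x _; rewrite mcoeffZ.
apply: big1 => x _; rewrite mcoeffZ memN_msupp_eq0 ?mulr0 //.
by apply: contra mNms; apply: vms.
Qed.

Lemma msizeM_leD (K : fieldType) (n : nat) (p q : {mpoly K[n]}) (a b : nat) :
  (msize p <= a.+1)%N -> (msize q <= b.+1)%N -> (msize (p * q) <= (a + b).+1)%N.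
Proof.
have [->|p0] := eqVneq p 0; first by rewrite mul0r msize0.
have [->|q0] := eqVneq q 0; first by rewrite mulr0 msize0.
rewrite msizeM //; move: (msize p) (msize q) => u v; lia.
Qed.

Lemma msize_exp_le (K : fieldType) (n : nat) (p : {mpoly K[n]}) (D e : nat) :
  (msize p <= D.+1)%N -> (msize (p ^+ e) <= (e * D).+1)%N.
Proof.
move=> pD; elim: e => [|e IHe]; first by rewrite expr0 mul0n -mpolyC1 msizeC oner_eq0.
by rewrite exprS mulSn; apply: msizeM_leD.
Qed.

(** If [k] exceeded [r], the [N ^ k] monomials in [h] with exponents below [N] would be linearly
    independent in a space of dimension [M ^ r] with [M] only linear in [N]; this fails for large
    [N]. *)
Lemma alg_indep_leq (K : fieldType) (k r : nat) (h : k.-tuple {mpoly K[r]}) :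
  (forall f : {mpoly K[k]}, f \mPo h = 0 -> f = 0) -> (k <= r)%N.
Proof.
move=> indh; rewrite leqNgt; apply/negP => r_lt_k.
pose D := (\max_i msize (tnth h i))%N.
have hD i : (msize (tnth h i) <= D.+1)%N by apply/leqW/(leq_bigmax i).
(* Here [M <= C * N], hence [M ^ r <= C ^ r * N ^ r < N ^ r.+1 <= N ^ k], because [N] exceeds
   [C ^ r]. *)
pose C := (k * D + 1)%N; pose N := (C ^ r).+1; pose M := (k * N * D + 1)%N.
pose mon (x : {ffun 'I_k -> 'I_N}) := [multinom (x i : nat) | i < k].
have mon_inj : injective mon.
  move=> x y /mnmP xy; apply/ffunP => i; apply: val_inj.
  by have := xy i; rewrite !mnmE.
pose ms := [seq [multinom (y i : nat) | i < r] | y : {ffun 'I_r -> 'I_M}].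
have : (#|{ffun 'I_k -> 'I_N}| <= size ms)%N.
  apply: (@leq_card_of_mpoly_indep K r _ (fun x => 'X_[mon x] \mPo h)).
    move=> x m /msize_mdeg_lt mlt.
    have ltM i : (m i < M)%N.
      apply: (@leq_ltn_trans (mdeg m)).
        by rewrite mdegE (bigD1 i) //= leq_addr.
      apply: (leq_trans mlt); rewrite comp_mpolyX /M addn1.
      apply: (@leq_trans (\sum_(j < k) (x j * D)).+1).
        elim/big_rec2: _ => [|j a p _ IH]; first by rewrite -mpolyC1 msizeC oner_eq0.
        by rewrite mnmE; apply: msizeM_leD => //; apply: msize_exp_le.
      have -> : (k * N * D = \sum_(j < k) N * D)%N.
        by rewrite sum_nat_const card_ord mulnA.
      by rewrite ltnS; apply: leq_sum => j _; rewrite leq_mul2r ltnW ?orbT.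
    apply/imageP; exists [ffun i => Ordinal (ltM i)] => //.
    by apply/mnmP => i; rewrite mnmE ffunE.
  move=> c c0 x.
  have /indh/(congr1 (mcoeff (mon x))) : (\sum_x c x *: 'X_[mon x]) \mPo h = 0.
    by rewrite -{}[RHS]c0 raddf_sum; apply: eq_bigr => y _; rewrite /= comp_mpolyZ.
  rewrite mcoeff0 raddf_sum (bigD1 x) //= mcoeffZ mcoeffX eqxx mulr1 big1 ?addr0 //.
  move=> y yx; rewrite mcoeffZ mcoeffX.
  by case: eqP => [/mon_inj /eqP|_]; rewrite ?(negPf yx) // mulr0.
rewrite /ms size_map -cardE !card_ffun !card_ord leqNgt => /negP; apply.
apply: (@leq_ltn_trans ((C * N) ^ r)).
  case: (posnP r) => [->//|r0].
  by rewrite leq_exp2r // /M /C mulnDl mul1n mulnAC leq_add2l.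
rewrite expnMn (@leq_trans (N ^ r.+1)) ?leq_pexp2l //.
by rewrite expnS ltn_pmul2r ?expn_gt0.
Qed.

(** * Algebra endomorphisms of the polynomial ring *)

Section KalgEndo.
Variables (K : fieldType) (n : nat) (pi : {mpoly K[n]} -> {mpoly K[n]}).
Hypothesis pi_endo : kalg_endo pi.

Lemma kalg_endo0 : pi 0 = 0.
Proof. by case: pi_endo => _ _ _ piZ; rewrite -[X in pi X](scale0r 0) piZ scale0r. Qed.

Lemma kalg_endo_sum (I : Type) (r : seq I) (P : pred I) (F : I -> {mpoly K[n]}) :
  pi (\sum_(i <- r | P i) F i) = \sum_(i <- r | P i) pi (F i).
Proof. by case: pi_endo => piD _ _ _; exact: (big_morph pi piD kalg_endo0). Qed.

Lemma kalg_endoE p : pi p = \sum_(m <- msupp p) p@_m *: pi 'X_[m].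
Proof.
case: pi_endo => _ _ _ piZ; rewrite {1}(mpolyE p) kalg_endo_sum.
by apply: eq_bigr => m _; rewrite piZ.
Qed.

Lemma kalg_endo_exp p e : pi (p ^+ e) = pi p ^+ e.
Proof.
case: pi_endo => _ piM pi1 _.
by elim: e => [|e IHe]; rewrite ?expr0 // !exprS piM IHe.
Qed.

Lemma kalg_endo_comp k (f : {mpoly K[k]}) (a : k.-tuple {mpoly K[n]}) :
  pi (f \mPo a) = f \mPo [tuple pi (tnth a i) | i < k].
Proof.
case: pi_endo => _ piM pi1 piZ.
rewrite !comp_mpolyE kalg_endo_sum; apply: eq_bigr => m _.
rewrite piZ (big_morph pi piM pi1); congr (_ *: _); apply: eq_bigr => i _.
by rewrite kalg_endo_exp tnth_mktuple.
Qed.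

End KalgEndo.

(** * From chains of primes to algebraically independent elements *)

(** A condition on supports, so that the ambient ring in [k] variables stays fixed while [j]
    grows. *)
Definition vars_below (K : fieldType) (k j : nat) (f : {mpoly K[k]}) :=
  forall m, m \in msupp f -> forall i : 'I_k, (j <= i)%N -> m i = 0%N.

(** Divide out the largest power of ['X_j]; the remaining terms free of ['X_j] form [g], which is
    then nonzero. The induction is on [msize], which drops at each division. *)
Lemma vars_below_split (K : fieldType) (k : nat) (j : 'I_k) (f : {mpoly K[k]}) :
  f != 0 -> vars_below j.+1 f ->
  exists e g h, [/\ f = 'X_j ^+ e * (g + 'X_j * h), g != 0 & vars_below j g].
Proof.
move: {2}(msize f) (leqnn (msize f)) => s; elim: s f => [|s IHs] f.
  by rewrite leqn0 msize_poly_eq0 => ->.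
move=> fs f0 fj.
pose g := \sum_(m <- msupp f | m j == 0%N) f@_m *: 'X_[m].
pose h := \sum_(m <- msupp f | m j != 0%N) f@_m *: 'X_[m - U_(j)].
have fE : f = g + 'X_j * h.
  rewrite {1}(mpolyE f) (bigID (fun m : 'X_{1..k} => m j == 0%N)) /=; congr (_ + _).
  rewrite mulr_sumr; apply: eq_bigr => m mj0.
  by rewrite -scalerAr -mpolyXD addmC submK // lep1mP.
have gj : vars_below j g.
  move=> m /msupp_sum_le /flattenP[_ /mapP[m' +] ->].
  rewrite mem_filter => /andP[m'j m'f] /msuppZ_le /mem_msuppXP <- i.
  rewrite leq_eqVlt => /predU1P[/val_inj<-|ji]; first exact/eqP.
  exact: fj m'f i ji.
have [g0|g0] := eqVneq g 0; last by exists 0%N, g, h; rewrite expr0 mul1r.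
rewrite g0 add0r in fE.
have h0 : h != 0 by apply: contraNneq f0 => h0; rewrite fE h0 mulr0.
have hs : (msize h <= s)%N.
  by move: fs; rewrite fE msizeM ?msizeX ?mdeg1 // -?msize_poly_eq0 ?msizeX.
have hj : vars_below j.+1 h.
  move=> m mh i ji; have : (m + U_(j))%MM \in msupp f.
    by rewrite mcoeff_msupp fE mulrC addmC mcoeffMX -mcoeff_msupp.
  by move/fj => /(_ i ji); rewrite mnmDE; case: (m i).
have [e [g' [h' [hE g'0 g'j]]]] := IHs h hs h0 hj.
by exists e.+1, g', h'; split=> //; rewrite fE hE exprS mulrA.
Qed.

Section KrullChain.
Variables (K : fieldType) (n : nat) (S : {mpoly K[n]} -> Prop).
Variable pi : {mpoly K[n]} -> {mpoly K[n]}.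
Hypothesis pi_endo : kalg_endo pi.
Hypothesis S_pi : forall p, S (pi p).
Hypothesis pi_id : forall p, S p -> pi p = p.

Lemma retract_comp k (f : {mpoly K[k]}) (a : k.-tuple {mpoly K[n]}) :
  (forall i, S (tnth a i)) -> S (f \mPo a).
Proof.
move=> Sa; suff <- : pi (f \mPo a) = f \mPo a by [].
rewrite kalg_endo_comp //; congr (_ \mPo _); apply: eq_from_tnth => i.
by rewrite tnth_mktuple pi_id.
Qed.

Lemma retractD p q : S p -> S q -> S (p + q).
Proof.
by case: pi_endo => piD _ _ _ Sp Sq; rewrite -(pi_id Sp) -(pi_id Sq) -piD.
Qed.

Lemma retractM p q : S p -> S q -> S (p * q).
Proof.
by case: pi_endo => _ piM _ _ Sp Sq; rewrite -(pi_id Sp) -(pi_id Sq) -piM.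
Qed.

Lemma retractC c : S c%:MP.
Proof.
case: pi_endo => _ _ pi1 piZ.
by rewrite -[c%:MP]mulr1 mul_mpolyC -pi1 -piZ.
Qed.

(* If [b] lies in [Q] but not in [P], then [b] is transcendental modulo [P] over
   any family that is algebraically independent modulo [Q]: a relation
   [b ^ e (g + b h)] in [P] forces [g + b h] in [P], hence [g] in [Q]. *)
Lemma alg_indep_extend k (j : 'I_k) (P Q : {mpoly K[n]} -> Prop) b
    (a : k.-tuple {mpoly K[n]}) :
  prime_of S P -> prime_of S Q -> (forall p, P p -> Q p) -> Q b -> ~ P b ->
  (forall i, S (tnth a i)) ->
  (forall f : {mpoly K[k]}, f != 0 -> vars_below j f -> ~ Q (f \mPo a)) ->
  exists a' : k.-tuple {mpoly K[n]}, (forall i, S (tnth a' i)) /\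
    forall f : {mpoly K[k]}, f != 0 -> vars_below j.+1 f -> ~ P (f \mPo a').
Proof.
move=> [_ _ primeP] [[subQ _ addQ mulQ] _ _] PQ Qb nPb Sa inda.
(* Overwriting entry [j] does not affect [g], which involves only earlier variables. *)
pose a' := [tuple if i == j then b else tnth a i | i < k].
have Sa' i : S (tnth a' i) by rewrite tnth_mktuple; case: eqP => // _; exact: subQ.
exists a'; split=> // f f0 /(vars_below_split f0)[e [g [h [-> g0 gj]]]].
have ga : g \mPo a' = g \mPo a.
  rewrite !comp_mpolyE; apply: eq_big_seq => m mg; congr (_ *: _).
  apply: eq_bigr => i _; rewrite tnth_mktuple; case: eqP => // ->.
  by rewrite (gj m mg) // !expr0.
rewrite rmorphM rmorphXn rmorphD rmorphM /= ga comp_mpolyXU -tnth_nth.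
rewrite tnth_mktuple eqxx.
have Sh := retract_comp h Sa'; have Sg := retract_comp g Sa.
have Sw : S ((g \mPo a) + b * (h \mPo a')).
  by apply/retractD/retractM => //; exact: subQ.
(* [P] is prime and [b] lies outside it, so the factors [b] are stripped one at a time. *)
elim: e => [|e IHe]; last first.
  rewrite exprS -mulrA => /primeP[||/nPb //|/IHe //]; first exact: subQ.
  apply: retractM => //; elim: {IHe} e => [|e IHe].
    by rewrite expr0 -mpolyC1; exact: retractC.
  by rewrite exprS; apply: retractM => //; exact: subQ.
rewrite expr0 mul1r => /PQ Qw; apply: (inda g g0 gj).
have -> : g \mPo a = (g \mPo a) + b * (h \mPo a') + (-1)%:MP * ((h \mPo a') * b).
  by rewrite mpolyCN mpolyC1 mulN1r [b * _]mulrC addrK.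
by apply: addQ Qw _; apply: (mulQ); [exact: retractC | exact: mulQ].
Qed.

(** The chain is descended from its top: after [j] steps, [j] elements are independent modulo
    [P (k - j)]. Independence modulo [P 0] implies independence, as [0] lies in [P 0]. *)
Lemma dim_ge_alg_indep k : dim_ge S k ->
  exists a : k.-tuple {mpoly K[n]}, (forall i, S (tnth a i)) /\
    forall f : {mpoly K[k]}, f \mPo a = 0 -> f = 0.
Proof.
move=> [P [primeP chainP]].
suff /(_ k (leqnn k)) [a [Sa inda]] : forall j, (j <= k)%N ->
    exists a : k.-tuple {mpoly K[n]}, (forall i, S (tnth a i)) /\
      forall f : {mpoly K[k]}, f != 0 -> vars_below j f -> ~ P (k - j)%N (f \mPo a).
  exists a; split=> // f fa0; apply/eqP; apply: contraT => f0; exfalso.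
  apply: (inda f f0); first by move=> m _ i; rewrite leqNgt ltn_ord.
  by have [[_ P0 _ _] _ _] := primeP (k - k)%N (leq_subr _ _); rewrite fa0.
elim=> [_|j IHj ltjk].
  (* Only nonzero constants are tested against the top prime; one of them in [P k] would put [1]
     there. The entries [0] are placeholders, overwritten later. *)
  exists [tuple 0 | i < k]; split=> [i|f f0 fC].
    by rewrite tnth_mktuple -(mpolyC0 n K); exact: retractC.
  have [[_ _ _ mulP] P1 _] := primeP k (leqnn k).
  have fE : f = (f@_0)%:MP.
    apply: msize1_polyC; rewrite msizeE; apply/bigmax_leqP_seq => m mf _.
    by rewrite ltnS leqn0 mdeg_eq0; apply/eqP/mnmP => i; rewrite mnm0E (fC m mf).
  rewrite subn0 fE comp_mpolyC => Pf; apply: P1.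
  rewrite -mpolyC1 -(@mulVf _ f@_0); last first.
    by apply: contraNneq f0 => f00; rewrite fE f00 mpolyC0.
  by rewrite mpolyCM; apply: mulP => //; exact: retractC.
have [a [Sa inda]] := IHj (ltnW ltjk).
have lt : (k - j.+1 < k)%N by rewrite ltn_subrL (leq_trans _ ltjk).
have [PQ [b [Qb nPb]]] := chainP _ lt; rewrite subnSK // in PQ Qb.
apply: (@alg_indep_extend k (Ordinal ltjk) _ (P (k - j)%N) b a) => //.
  by apply: primeP; rewrite leq_subr.
by apply: primeP; rewrite leq_subr.
Qed.

End KrullChain.

(** * Independent linear forms in a retract *)

Lemma comp_mpolyA (K : fieldType) (k r n : nat) (f : {mpoly K[k]})
    (a : k.-tuple {mpoly K[r]}) (b : r.-tuple {mpoly K[n]}) :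
  (f \mPo a) \mPo b = f \mPo [tuple tnth a i \mPo b | i < k].
Proof.
rewrite !(comp_mpolyE f) raddf_sum; apply: eq_bigr => m _ /=.
rewrite comp_mpolyZ rmorph_prod /=; congr (_ *: _); apply: eq_bigr => i _.
by rewrite rmorphXn /= tnth_mktuple.
Qed.

Lemma homog1_linearE (K : fieldType) (n : nat) (p : {mpoly K[n]}) :
  homog1 1 p -> p = \sum_i p@_U_(i) *: 'X_i.
Proof.
move=> p1; apply/mpolyP => m; rewrite raddf_sum /=.
have [/mdeg1P[i /eqP->]|m1] := boolP (mdeg m == 1%N).
  rewrite (bigD1 i) //= mcoeffZ mcoeffX eqxx mulr1 big1 ?addr0 // => j ji.
  by rewrite mcoeffZ mcoeffX eq_mnm1 (negPf ji) mulr0.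
rewrite memN_msupp_eq0; last by apply: contra m1 => /p1 [->].
rewrite big1 // => j _; rewrite mcoeffZ mcoeffX; case: eqP => [jm|]; last by rewrite mulr0.
by rewrite -jm mdeg1 in m1.
Qed.

(* The retract is generated by its linear forms, so their span has dimension at
   least the number of algebraically independent elements. *)
Lemma dim_ge_linear_indep (K : fieldType) (n : nat) (S : {mpoly K[n]} -> Prop)
    (pi : {mpoly K[n]} -> {mpoly K[n]}) (k : nat) :
  kalg_endo pi -> (forall p, S (pi p)) -> (forall p, S p -> pi p = p) ->
  (forall j, homog1 1 (pi 'X_j)) -> dim_ge S k ->
  exists D : 'M[K]_(k, n), forall c : 'I_k -> K,
    \sum_l c l *: (\sum_j D l j *: pi 'X_j) = 0 -> forall l, c l = 0.
Proof.
move=> pi_endo S_pi pi_id pi1 /(dim_ge_alg_indep pi_endo S_pi pi_id)[a [Sa inda]].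
pose G := \matrix_(j < n, l < n) (pi 'X_j)@_U_(l).
have piX j : pi 'X_j = \sum_l G j l *: 'X_l.
  by rewrite {1}(homog1_linearE (pi1 j)); apply: eq_bigr => l _; rewrite mxE.
(* The rank factorization [G = col_base G *m row_base G] writes each [pi 'X_j] as the linear form
   [tnth L j] in the [\rank G] forms [y]. *)
pose y := [tuple \sum_i row_base G l i *: 'X_i : {mpoly K[n]} | l < \rank G].
pose L := [tuple \sum_l col_base G j l *: 'X_l : {mpoly K[\rank G]} | j < n].
have Ly : [tuple tnth L j \mPo y | j < n] = [tuple pi 'X_j | j < n].
  apply: eq_from_tnth => j; rewrite !tnth_mktuple piX raddf_sum /=.
  under eq_bigr do rewrite linearZ /= comp_mpolyXU -tnth_nth tnth_mktuple scaler_sumr.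
  rewrite exchange_big; apply: eq_bigr => i _.
  rewrite -[in RHS](mulmx_base G) mxE scaler_suml.
  by apply: eq_bigr => l _; rewrite scalerA.
(* Applying [pi] substitutes [pi 'X_j] for ['X_j], and [pi] fixes [tnth a i]; so the latter is a
   polynomial in [y]. *)
have aE i : tnth a i = (tnth a i \mPo L) \mPo y.
  rewrite comp_mpolyA Ly -{1}(pi_id _ (Sa i)) -{1}[tnth a i]comp_mpoly_id.
  rewrite kalg_endo_comp //; congr (_ \mPo _); apply: eq_from_tnth => j.
  by rewrite !tnth_mktuple.
have leqkr : (k <= \rank G)%N.
  apply: (@alg_indep_leq K k _ [tuple tnth a i \mPo L | i < k]) => f f0.
  apply: inda.
  have -> : a = [tuple tnth (mktuple (fun i => tnth a i \mPo L)) i \mPo y | i < k].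
    by apply: eq_from_tnth => i; rewrite !tnth_mktuple -aE.
  by rewrite -comp_mpolyA f0 comp_mpoly0.
have /submxP[E EG] : (row_base G <= G)%MS by rewrite eq_row_base.
(* [E] expresses [row_base G] through the rows of [G], and [pid_mx k] keeps the first [k] of these
   combinations. *)
exists (pid_mx k *m E) => c c0 l.
have freeB : row_free (pid_mx k *m E *m G : 'M[K]_(k, n)).
  rewrite -mulmxA -EG /row_free mxrankMfree ?row_base_free // rank_pid_mx //.
suff /rowP/(_ l) : \row_l c l = 0 by rewrite !mxE.
apply: (row_free_inj freeB); rewrite mul0mx; apply/rowP => i; rewrite [RHS]mxE.
have /(congr1 (mcoeff U_(i)%MM)) := c0; rewrite mcoeff0 raddf_sum => c0i.
rewrite -[RHS]c0i mxE; apply: eq_bigr => l' _.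
rewrite [X in X * _]mxE mxE /= mcoeffZ raddf_sum /=; congr (_ * _).
by apply: eq_bigr => j _; rewrite mcoeffZ [G _ _]mxE.
Qed.

(** * Degrees one and two of a Hilbert decomposition *)

Section HilbertUpperBound.
Variables (K : fieldType) (n k : nat).
Local Notation R := {mpoly K[n]}.
Variables (S : 'I_k -> R -> Prop) (pi : 'I_k -> R -> R).
Variables (phi : {ffun 'I_k -> R} -> R) (sigma : 'I_k -> int).

(** The map induced by [phi] on the [i]-th summand. Inserting [pi i] extends it to all of [R], since
    [phi] is constrained only on tuples from the retracts. *)
Definition summand_map (i : 'I_k) (p : R) : R :=
  phi [ffun j => if j == i then pi i p else 0].
Local Notation psi := summand_map.

Hypothesis n_gt0 : (0 < n)%N.
Hypothesis pi_endo : forall i, kalg_endo (pi i).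
Hypothesis S_pi : forall i p, S i (pi i p).
Hypothesis pi_id : forall i p, S i p -> pi i p = p.
Hypothesis phi_linear : forall (c : K) (t u : {ffun 'I_k -> R}),
  (forall i, S i (t i)) -> (forall i, S i (u i)) ->
  phi [ffun i => c *: t i + u i] = c *: phi t + phi u.
Hypothesis phi_max : forall t : {ffun 'I_k -> R},
  (forall i, S i (t i)) -> maxideal (phi t).
Hypothesis phi_inj : forall t u : {ffun 'I_k -> R},
  (forall i, S i (t i)) -> (forall i, S i (u i)) -> phi t = phi u -> t = u.
Hypothesis phi_surj : forall p, maxideal p ->
  exists t : {ffun 'I_k -> R}, (forall i, S i (t i)) /\ phi t = p.
(** Homogeneity enters the count only through this and [psi_homog], so both gradings can be treated
    through total degrees. *)
Hypothesis pi_homog : forall i j, homog1 1 (pi i 'X_j).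
Hypothesis psi_homog : forall i m, homog1 ((mdeg m)%:Z + sigma i) (psi i 'X_[m]).

(** Projecting componentwise turns [phi] into a map that is linear on all tuples. *)
Let Psi (t : {ffun 'I_k -> R}) := phi [ffun i => pi i (t i)].

Let Psi_lin c t u : Psi (c *: t + u) = c *: Psi t + Psi u.
Proof.
rewrite /Psi -phi_linear; do ?[by move=> i; rewrite ffunE].
congr phi; apply/ffunP => i; rewrite !ffunE.
by case: (pi_endo i) => piD _ _ piZ; rewrite piD piZ.
Qed.

Let Psi0 : Psi 0 = 0.
Proof.
have := Psi_lin 1 0 0; rewrite !scale1r addr0 => /eqP.
by rewrite -subr_eq subrr eq_sym => /eqP.
Qed.

Let PsiZ c t : Psi (c *: t) = c *: Psi t.
Proof. by rewrite -[c *: t]addr0 Psi_lin Psi0 addr0. Qed.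

Let PsiD t u : Psi (t + u) = Psi t + Psi u.
Proof. by rewrite -[t]scale1r Psi_lin !scale1r. Qed.

Let single (i : 'I_k) (p : R) : {ffun 'I_k -> R} := [ffun j => if j == i then p else 0].

Let psiE i p : psi i p = Psi (single i p).
Proof.
congr phi; apply/ffunP => j; rewrite !ffunE.
by case: eqP => [->//|_]; rewrite (kalg_endo0 (pi_endo j)).
Qed.

Let psi_expand i p : psi i p = \sum_(m <- msupp p) p@_m *: psi i 'X_[m].
Proof.
have -> : psi i p = Psi (\sum_(m <- msupp p) p@_m *: single i 'X_[m]).
  rewrite psiE; congr Psi; apply/ffunP => j; rewrite sum_ffunE ffunE.
  case: eqP => [->|/eqP/negPf ji].
    by rewrite {1}(mpolyE p); apply: eq_bigr => m _; rewrite !ffunE eqxx.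
  by rewrite big1 // => m _; rewrite !ffunE ji scaler0.
rewrite (big_morph Psi PsiD Psi0).
by apply: eq_bigr => m _; rewrite PsiZ psiE.
Qed.

Let phi_expand (t : {ffun 'I_k -> R}) : (forall i, S i (t i)) -> phi t = \sum_i psi i (t i).
Proof.
move=> St; have -> : phi t = Psi (\sum_i single i (t i)).
  congr phi; apply/ffunP => j; rewrite ffunE sum_ffunE (bigD1 j) //= big1.
    by rewrite addr0 ffunE eqxx pi_id.
  by move=> i ij; rewrite ffunE eq_sym (negPf ij).
by rewrite (big_morph Psi PsiD Psi0); apply: eq_bigr => i _; rewrite psiE.
Qed.

Let Psi_inj t i : Psi t = 0 -> pi i (t i) = 0.
Proof.
move=> t0; have inj_t := @phi_inj [ffun i => pi i (t i)]
  [ffun i => pi i ((0 : {ffun 'I_k -> R}) i)].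
have /ffunP/(_ i) : [ffun i => pi i (t i)] = [ffun i => pi i ((0 : {ffun 'I_k -> R}) i)].
  by apply: inj_t => [j|j|]; rewrite ?ffunE // -/(Psi t) t0 -/(Psi 0) Psi0.
by rewrite !ffunE (kalg_endo0 (pi_endo i)).
Qed.

(** [psi i 1] is nonzero of degree [sigma i], and an element of the maximal ideal has no constant
    term. *)
Let sigma_gt0 i : 0 < sigma i.
Proof.
have psi1 : psi i 1 != 0.
  apply/eqP; rewrite psiE => /(@Psi_inj _ i); rewrite ffunE eqxx.
  by case: (pi_endo i) => _ _ -> _ /eqP; rewrite oner_eq0.
have := @psi_homog i 0%MM; rewrite mpolyX0 mdeg0 add0r => hom1.
have [m m1] : exists m, m \in msupp (psi i 1).
  by move: psi1; rewrite -msupp_eq0; case: (msupp _) => [//|m s] _;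
    exists m; rewrite mem_head.
rewrite -(hom1 m m1) ltz_nat lt0n mdeg_eq0.
apply: contraTneq m1 => ->; rewrite -mcoeff_eq0.
have [c ->] : maxideal (psi i 1).
  by apply: phi_max => j; rewrite ffunE; case: eqP => [->//|_];
    rewrite -(kalg_endo0 (pi_endo j)).
rewrite raddf_sum /= big1 // => j _.
by rewrite rmorphM /= mcoeffX mnm1_eq0 mulr0.
Qed.

Let I1 := [set i | sigma i == 1].

(** Each variable is a combination of the [psi i 1] with [i] in [I1]: all shifts being positive,
    nothing else reaches degree one. *)
Let leq_card_I1 : (n <= #|I1|)%N.
Proof.
have surjX (j : 'I_n) : exists t : {ffun 'I_k -> R}, (forall i, S i (t i)) /\ phi t = 'X_j.
  apply: phi_surj.
  exists (fun i => (i == j)%:R); rewrite (bigD1 j) //= eqxx mul1r big1 ?addr0 //.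
  by move=> i /negPf ->; rewrite mul0r.
have [t tP] := fin_all_exists surjX.
(* The identity matrix of size [n] factors through [#|I1|] coordinates. *)
have tE j l : (j == l)%:R = \sum_(i < #|I1|)
    (t j (enum_val i))@_0 * (psi (enum_val i) 1)@_U_(l) :> K.
  have [St /(congr1 (mcoeff U_(l)%MM))] := tP j.
  rewrite mcoeffXU => <-; rewrite phi_expand // raddf_sum /=.
  rewrite -(big_enum_val (A := mem I1) (fun i => (t j i)@_0 * (psi i 1)@_U_(l))) /=.
  rewrite [RHS]big_mkcond; apply: eq_bigr => i _.
  rewrite psi_expand raddf_sum inE /=.
  have z m : ((mdeg m)%:Z + sigma i != 1) -> (psi i 'X_[m])@_U_(l) = 0.
    move=> mi; apply: memN_msupp_eq0.
    by apply: contra mi => /psi_homog; rewrite mdeg1 => <-.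
  case: ifPn => [/eqP si|si]; last first.
    apply: big1_seq => m _; rewrite mcoeffZ z ?mulr0 //.
    by apply: contra si; have := sigma_gt0 i; move: (sigma i) (mdeg m) => s d; lia.
  have [m0|m0] := boolP (0%MM \in msupp (t j i)).
    rewrite (bigD1_seq 0%MM) ?msupp_uniq //= mcoeffZ mpolyX0 big1 ?addr0 // => m m_n0.
    rewrite mcoeffZ z ?mulr0 // si -subr_eq0 addrK.
    by rewrite eqz_nat mdeg_eq0.
  rewrite (memN_msupp_eq0 m0) mul0r; apply: big1_seq => m /andP[_ mt].
  rewrite mcoeffZ z ?mulr0 // si -subr_eq0 addrK eqz_nat mdeg_eq0.
  by apply: contraNneq m0 => <-.
rewrite -[n]card_ord -[#|I1|]card_ord.
apply: (@leq_card_of_row_indep K _ _ (fun j i => (t j (enum_val i))@_0)) => c c0 l.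
have -> : c l = \sum_j c j * (j == l)%:R.
  rewrite (bigD1 l) //= eqxx mulr1 big1 ?addr0 // => j /negPf ->.
  by rewrite mulr0.
under eq_bigr do rewrite tE mulr_sumr.
rewrite exchange_big big1 //= => i _.
by under eq_bigr do rewrite mulrA; rewrite -mulr_suml c0 mul0r.
Qed.

(** At least [n] summands have shift one, and each sends [q] independent linear forms into degree
    two; but [n * q] exceeds the number [n (n + 1) / 2] of monomials there. *)
Lemma hilbert_depth_upper_bound : ~ (forall i, dim_ge (S i) (n.+1./2).+1).
Proof.
move=> dimS; set q := (n.+1./2).+1.
have exD (i : 'I_k) : exists D : 'M[K]_(q, n), forall c : 'I_q -> K,
    \sum_l c l *: (\sum_j D l j *: pi i 'X_j) = 0 -> forall l, c l = 0.
  by apply: (@dim_ge_linear_indep K n (S i)) => //; exact: pi_id.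
have [D indD] := fin_all_exists exD.
pose y i l : R := \sum_j D i l j *: 'X_j.
have pi_y i l : pi i (y i l) = \sum_j D i l j *: pi i 'X_j.
  case: (pi_endo i) => _ _ _ piZ.
  by rewrite kalg_endo_sum //; apply: eq_bigr => j _; rewrite piZ.
have : (#|{: 'I_#|I1| * 'I_q}|
          <= size [seq s2m (t : 2.-tuple 'I_n) | t <- enum (basis n 2)])%N.
  apply: (@leq_card_of_mpoly_indep K n _
           (fun x => psi (enum_val x.1) (y (enum_val x.1) x.2))).
    move=> [x l] m /=; set i := enum_val x.
    have si : sigma i = 1 by have := enum_valP x; rewrite inE => /eqP.
    have -> : psi i (y i l) = \sum_j D i l j *: psi i 'X_j.
      have -> : psi i (y i l) = Psi (\sum_j D i l j *: single i 'X_j).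
        rewrite psiE; congr Psi; apply/ffunP => j; rewrite sum_ffunE ffunE.
        case: eqP => [->|/eqP/negPf ji].
          by apply: eq_bigr => m' _; rewrite !ffunE eqxx.
        by rewrite big1 // => m' _; rewrite !ffunE ji scaler0.
      rewrite (big_morph Psi PsiD Psi0).
      by apply: eq_bigr => j _; rewrite PsiZ psiE.
    move=> /msupp_sum_le /flattenP[_ /mapP[j _ ->]] /msuppZ_le /psi_homog.
    by rewrite mdeg1 si -basis_cover => -[->].
  (* Injectivity of [phi] isolates component [i0], to which the other summands contribute zero. *)
  move=> c c0 [x0 l]; set i0 := enum_val x0.
  have /(@Psi_inj _ i0) :
    Psi (\sum_x c x *: single (enum_val x.1) (y (enum_val x.1) x.2)) = 0.
    rewrite (big_morph Psi PsiD Psi0) -[RHS]c0.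
    by apply: eq_bigr => x _; rewrite PsiZ psiE.
  pose F (x : 'I_#|I1|) l := (c (x, l) *: single (enum_val x) (y (enum_val x) l)) i0.
  rewrite sum_ffunE (eq_bigr (fun x => F x.1 x.2)) => [|[] //]; rewrite -(pair_bigA _ F) /=.
  rewrite (bigD1 x0) //= [X in _ + X]big1 ?addr0; last first.
    move=> x xx0; apply: big1 => l' _; rewrite /F !ffunE.
    by rewrite (inj_eq enum_val_inj) eq_sym (negPf xx0) scaler0.
  move=> ci0; apply: (indD i0 (fun l => c (x0, l))); rewrite -[RHS]ci0 kalg_endo_sum //.
  case: (pi_endo i0) => _ _ _ piZ.
  by apply: eq_bigr => l' _; rewrite /F !ffunE eqxx piZ pi_y.
rewrite card_prod !card_ord leqNgt => /negP; apply.
apply: leq_trans (leq_mul leq_card_I1 (leqnn q)).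
(* With [n = n'.+1], degree two has [(n'.+2 * n'.+1)./2] monomials; after doubling it remains to see
   [n'.+2 < q.*2], by parity. *)
rewrite /q; case: n n_gt0 => // n' _; rewrite size_basis add2n bin2 succnK.
rewrite -ltn_double doubleMr; apply: leq_ltn_trans (_ : n'.+2 * n'.+1 < _)%N.
  by rewrite -[X in (_ <= X)%N]odd_double_half leq_addl.
rewrite mulnC ltn_pmul2l // doubleS -[X in (X < _)%N]odd_double_half.
by case: odd; rewrite ?add1n ?add0n ltnS.
Qed.

End HilbertUpperBound.

(** * Comparison of gradings and of decompositions *)

Section Gradings.
Variables (K : fieldType) (n : nat).
Local Notation R := {mpoly K[n]}.

Lemma mdeg_sumz (m : 'X_{1..n}) : (mdeg m)%:Z = \sum_i (m i)%:Z.
Proof. by rewrite mdegE (big_morph Posz PoszD (erefl 0%:Z)). Qed.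

Lemma homogn_homog1 (a : 'I_n -> int) (p : R) : homogn a p -> homog1 (\sum_i a i) p.
Proof.
move=> pa m mp; rewrite mdeg_sumz.
by apply: eq_bigr => i _; exact: pa.
Qed.

Lemma homogX1 (m : 'X_{1..n}) : homog1 (mdeg m)%:Z ('X_[m] : R).
Proof. by move=> m' /mem_msuppXP <-. Qed.

Lemma homogXn (m : 'X_{1..n}) : homogn (fun i => (m i)%:Z) ('X_[m] : R).
Proof. by move=> m' /mem_msuppXP <-. Qed.

Lemma homog1D d (p q : R) : homog1 d p -> homog1 d q -> homog1 d (p + q).
Proof. by move=> hp hq m /msuppD_le; rewrite mem_cat => /orP[/hp|/hq]. Qed.

Lemma homognD d (p q : R) : homogn d p -> homogn d q -> homogn d (p + q).
Proof. by move=> hp hq m /msuppD_le; rewrite mem_cat => /orP[/hp|/hq]. Qed.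

Lemma homog1_0 d : homog1 d (0 : R).
Proof. by move=> m; rewrite msupp0. Qed.

Lemma homogn_0 d : homogn d (0 : R).
Proof. by move=> m; rewrite msupp0. Qed.

Lemma homog1M d e (p q : R) : homog1 (sub1 d e) p -> homog1 e q -> homog1 d (p * q).
Proof.
move=> hp hq m /msuppM_le /allpairsP[[u v] /= [/hp up /hq vq ->]].
by rewrite mdegD PoszD up vq /sub1 subrK.
Qed.

Lemma homognM d e (p q : R) :
  homogn (subn_deg d e) p -> homogn e q -> homogn d (p * q).
Proof.
move=> hp hq m /msuppM_le /allpairsP[[u v] /= [/hp up /hq vq ->]] i.
by rewrite mnmDE PoszD up vq /subn_deg subrK.
Qed.

(** Monomials suffice: each is multihomogeneous, so [pi] preserves its total degree, and linearity
    extends this to sums. *)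
Lemma graded_retractn1 (S : R -> Prop) :
  graded_retract (@homogn K n) S -> graded_retract (@homog1 K n) S.
Proof.
case=> pi [pi_endo pi_hom S_pi pi_id]; exists pi; split=> // d p pd m.
rewrite kalg_endoE // => /msupp_sum_le /flattenP[_ /mapP[m' +] ->].
rewrite filter_predT => m'p /msuppZ_le /(homogn_homog1 (pi_hom _ _ (@homogXn m'))) ->.
by rewrite -(pd m' m'p) mdeg_sumz.
Qed.

Lemma stanley_decn1 (M : R -> Prop) k (S : 'I_k -> R -> Prop) (x : 'I_k -> R) :
  stanley_dec (@homogn K n) M S x -> stanley_dec (@homog1 K n) M S x.
Proof.
case=> retrS xM annx decM dirM; split=> // i; first exact: graded_retractn1.
by have [Mx [d xd]] := xM i; split=> //; exists (\sum_i d i); exact: homogn_homog1.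
Qed.

(** The isomorphism sends [t] to [\sum_i t i * x i], with the degrees of the [x i] as shifts;
    directness and trivial annihilators give injectivity. The grading is kept abstract to serve both
    cases. *)
Lemma stanley_dec_hilbert_dec (D : Type) (hom : D -> R -> Prop) (sub : D -> D -> D)
    (M : R -> Prop) k (S : 'I_k -> R -> Prop) (x : 'I_k -> R) :
  (forall d, hom d 0) ->
  (forall d p q, hom d p -> hom d q -> hom d (p + q)) ->
  (forall d e p q, hom (sub d e) p -> hom e q -> hom d (p * q)) ->
  stanley_dec hom M S x -> exists s, hilbert_dec hom sub M S s.
Proof.
move=> hom0 homD homM [retrS xM annx decM dirM].
have [s xs] := fin_all_exists (fun i => (xM i).2).
exists s; split=> //; exists (fun t : {ffun 'I_k -> R} => \sum_i t i * x i); split.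
- move=> c t u _ _; rewrite scaler_sumr -big_split; apply: eq_bigr => i _ /=.
  by rewrite ffunE mulrDl scalerAl.
- by move=> t St; apply/decM; exists t.
- move=> t u St Su tu; apply/ffunP => i; apply/eqP; rewrite -subr_eq0; apply/eqP.
  have Stu j : S j (t j - u j).
    have [pi [[piD _ _ piZ] _ S_pi pi_id]] := retrS j.
    by rewrite -(pi_id _ (St j)) -(pi_id _ (Su j)) -scaleN1r -piZ -piD.
  apply: (annx i) (Stu i) _.
  have := @dirM [ffun j => t j - u j]; rewrite -[_ * _]/((fun j => (t j - u j) * x j) i).
  move=> dirtu; have := dirtu _ _ i; rewrite ffunE; apply.
    by move=> j; rewrite ffunE.
  under eq_bigr do rewrite ffunE mulrBl.
  by rewrite sumrB tu subrr.
- by move=> p /decM[t [St ->]]; exists t.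
- move=> d t tP; elim/big_rec: _ => // i p _ IH; apply: homD => //.
  exact: homM (tP i).2 (xs i).
Qed.

Lemma hilbert_dec1_upper_bound k (S : 'I_k -> R -> Prop) s : (0 < n)%N ->
  hilbert_dec (@homog1 K n) sub1 (@maxideal K n) S s ->
  ~ (forall i, dim_ge (S i) (n.+1./2).+1).
Proof.
move=> n_gt0 [/fin_all_exists[pi piP] [phi [lin maxM inj surj hom]]].
have endo i : kalg_endo (pi i) by case: (piP i).
have S_pi i p : S i (pi i p) by case: (piP i).
have pi_id i p : S i p -> pi i p = p by case: (piP i) => _ _ _; exact.
apply: (@hilbert_depth_upper_bound K n k S pi phi s) => // i.
  by move=> j; case: (piP i) => _ + _ _; apply; have := @homogX1 U_(j)%MM; rewrite mdeg1.
move=> m; apply: hom => j; rewrite ffunE; case: eqP => [->|_].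
  split=> //; rewrite /sub1 addrK; case: (piP i) => _ + _ _; apply; exact: homogX1.
by split; [rewrite -(kalg_endo0 (endo j)) | exact: homog1_0].
Qed.

Lemma hilbert_decn_upper_bound k (S : 'I_k -> R -> Prop) s : (0 < n)%N ->
  hilbert_dec (@homogn K n) (@subn_deg n) (@maxideal K n) S s ->
  ~ (forall i, dim_ge (S i) (n.+1./2).+1).
Proof.
move=> n_gt0 [/fin_all_exists[pi piP] [phi [lin maxM inj surj hom]]].
have endo i : kalg_endo (pi i) by case: (piP i).
have S_pi i p : S i (pi i p) by case: (piP i).
have pi_id i p : S i p -> pi i p = p by case: (piP i) => _ _ _; exact.
have pi_hom i d p : homogn d p -> homogn d (pi i p) by case: (piP i) => _ + _ _; exact.
apply: (@hilbert_depth_upper_bound K n k S pi phi (fun i => \sum_j s i j)) => // i.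
  move=> j; have := homogn_homog1 (pi_hom i _ _ (@homogXn U_(j)%MM)).
  by rewrite -mdeg_sumz mdeg1.
move=> m; rewrite mdeg_sumz -big_split /=.
apply: homogn_homog1; apply: hom => j; rewrite ffunE; case: eqP => [->|_].
  split=> // m' m'p l; rewrite /subn_deg addrK; exact: (pi_hom i _ _ (@homogXn m)) m'p l.
by split; [rewrite -(kalg_endo0 (endo j)) | exact: homogn_0].
Qed.

End Gradings.

(** * Kernels and independent sets on a cycle *)

Section CyclicKernel.
Variable N : nat.
Implicit Types (C E : {set 'I_N.+1}) (p : 'I_N.+1).

(** One equation encodes both kernel axioms for the arcs from [p] to [ordS p] outside [C]:
    independence, and absorption of every other vertex. Arcs into [C] are harmless because [E]
    avoids [C]. *)
Definition is_kernel C E := forall p, (p \in E) = (p \notin C) && (ordS p \notin E).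

Lemma iter_ordS d p : iter d (@ordS N.+1) p = ((p + d) %% N.+1)%N :> nat.
Proof.
elim: d => [|d IHd]; first by rewrite addn0 modn_small.
by rewrite iterS /= IHd -addn1 modnDml addn1 addnS.
Qed.

Lemma ordS_orbit p q : exists d, iter d (@ordS N.+1) p = q.
Proof.
(* Adding [N.+1] first avoids truncated subtraction. *)
exists (q + N.+1 - p)%N; apply: val_inj; rewrite [LHS]iter_ordS subnKC.
  by rewrite modnDr modn_small.
by rewrite (leq_trans (ltnW (ltn_ord p))) ?leq_addl.
Qed.

(** Membership is settled at points of [C] and elsewhere determined by the successor; walking
    forward from any [p] reaches [C]. *)
Lemma kernel_unique C E E' : C != set0 -> is_kernel C E -> is_kernel C E' -> E = E'.
Proof.
move=> /set0Pn[c cC] kE kE'; apply/setP => p.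
have [d] := ordS_orbit p c; elim: d p => [|d IHd] p.
  by rewrite /= => ->; rewrite kE kE' cC.
by rewrite iterSr => /IHd pE; rewrite kE kE' pE.
Qed.

(* [p] is in the kernel iff the run of non-elements of [C] starting at [p] has
   odd length. *)
Lemma kernel_exists C : C != set0 -> exists E, is_kernel C E.
Proof.
move=> /set0Pn[c cC].
have exC p : exists d, iter d (@ordS N.+1) p \in C.
  by have [d dc] := ordS_orbit p c; exists d; rewrite dc.
exists [set p | odd (ex_minn (exC p))] => p; rewrite !inE.
case: ex_minnP => [[|d] dC minp] /=; first by rewrite dC.
have -> : p \notin C by apply/negP => pC; have := minp 0%N pC.
(* The run starting at the successor is shorter by one, so the parity flips. *)
case: ex_minnP => e eC mine /=; have -> : e = d; last by [].
apply/eqP; rewrite eqn_leq mine -?iterSr //= -ltnS.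
by apply: minp; rewrite iterSr.
Qed.

Definition cycle_indep E := [forall p in E, ordS p \notin E].

(** These points are outside [E] although their successors are too, so they belong to every [C] with
    kernel [E]. *)
Definition free_part E := [set p | (p \notin E) && (ordS p \notin E)].

(** [E] and the set of its predecessors are disjoint and equinumerous. *)
Lemma cycle_indep_disjoint E : cycle_indep E ->
  #|E :|: (@ordS N.+1) @^-1: E| = (#|E|.*2)%N.
Proof.
move=> /forall_inP indE; rewrite cardsU card_preimset; last exact: ordS_inj.
rewrite -addnn (_ : _ :&: _ = set0) ?cards0 ?subn0 //.
by apply/setP => p; rewrite !inE; apply/negP => /andP[/indE /negP].
Qed.

Lemma card_cycle_indep E : cycle_indep E -> (#|E|.*2 <= N.+1)%N.
Proof.
by move=> /cycle_indep_disjoint <-; rewrite -[X in (_ <= X)%N]card_ord max_card.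
Qed.

(** Otherwise [E] and its predecessors would split a cycle of odd length [N.+1] into two sets of
    equal size. *)
Lemma free_part_neq0 E : ~~ odd N -> cycle_indep E -> free_part E != set0.
Proof.
move=> oddN /cycle_indep_disjoint cE; apply/negP => /eqP A0.
have : E :|: (@ordS N.+1) @^-1: E = setT.
  apply/setP => p; have := in_set0 p; rewrite -A0 !inE.
  by case: (p \in E); case: (_ \in E).
move=> EE; move: cE; rewrite EE cardsT card_ord => /(congr1 odd).
by rewrite odd_double /= oddN.
Qed.

End CyclicKernel.

(* On a cycle of odd length, the intervals [free_part E, ~: E] indexed by the
   independent sets [E] partition the nonempty subsets; for even [n] one restricts
   the partition of the subsets of an [n+1]-cycle to those missing a given point. *)
Lemma interval_partition n : exists k (A B : 'I_k -> {set 'I_n}),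
  [/\ forall i, (A i != set0) && (A i \subset B i),
      forall C : {set 'I_n}, C != set0 -> exists i, (A i \subset C) && (C \subset B i),
      forall i j (C : {set 'I_n}), (A i \subset C) && (C \subset B i) ->
                    (A j \subset C) && (C \subset B j) -> i = j &
      forall i, (n.+1./2 <= #|B i|)%N].
Proof.
(* [N.+1] is always odd: it is [n] for odd [n] and [n.+1] for even [n]. *)
pose N := (n./2).*2; have leqnN : (n <= N.+1)%N.
  by rewrite -{1}(odd_double_half n) /N; case: odd; rewrite ?add1n // add0n.
pose w := widen_ord leqnN; have w_inj : injective w.
  by move=> x y /(congr1 val) /= xy; apply: val_inj.
(* The inclusion keeps exactly those intervals that contain a subset of the image of [w]. *)
pose I := [set E : {set 'I_N.+1} | cycle_indep E && (free_part E \subset w @: setT)].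
pose A (i : 'I_#|I|) := w @^-1: free_part (enum_val i).
pose B (i : 'I_#|I|) := w @^-1: ~: enum_val i.
have indI (i : 'I_#|I|) : cycle_indep (enum_val i).
  by have := enum_valP i; rewrite inE => /andP[].
have freeI (i : 'I_#|I|) : free_part (enum_val i) \subset w @: setT.
  by have := enum_valP i; rewrite inE => /andP[].
have kerI i (C : {set 'I_n}) : (A i \subset C) && (C \subset B i) ->
    is_kernel (w @: C) (enum_val i).
  move=> /andP[/subsetP AC /subsetP CB] p; apply/idP/andP => [pE|[pC pE]].
    split; last by have /forall_inP := indI i; apply.
    by apply/imsetP => -[c /CB]; rewrite !inE => cE pc; rewrite -pc pE in cE.
  apply: contraR pC => pNE; have pA : p \in free_part (enum_val i).
    by rewrite inE pNE.
  have /subsetP/(_ p pA)/imsetP[c _ pc] := freeI i.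
  by rewrite pc imset_f // AC // inE -pc.
have A0 i : A i != set0.
  have /set0Pn[p pA] : free_part (enum_val i) != set0.
    by apply: free_part_neq0; rewrite ?odd_double.
  have /subsetP/(_ p pA)/imsetP[c _ pc] := freeI i.
  by apply/set0Pn; exists c; rewrite inE -pc.
exists #|I|, A, B; split.
- by move=> i; rewrite A0; apply/subsetP => c; rewrite !inE => /andP[].
- move=> C C0; have wC0 : w @: C != set0 by rewrite imset_eq0.
  have [E kE] := kernel_exists wC0.
  have AE p : p \in free_part E -> p \in w @: C.
    by rewrite inE => /andP[pNE pE]; move: pNE; rewrite kE pE andbT negbK.
  have EI : E \in I.
    rewrite inE; apply/andP; split.
      by apply/forall_inP => p; rewrite (kE p) => /andP[].
    by apply/subsetP => p /AE; apply/subsetP/imsetS/subsetT.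
  exists (enum_rank_in EI E); rewrite /A /B enum_rankK_in //.
  apply/andP; split; apply/subsetP => c; rewrite inE.
    by move=> /AE; rewrite mem_imset.
  by move=> cC; rewrite inE kE imset_f.
- move=> i j C iC jC; apply: enum_val_inj.
  apply: (@kernel_unique _ (w @: C)); [|exact: kerI|exact: kerI].
  rewrite imset_eq0; apply: contraTneq iC => ->.
  by rewrite negb_and subset0 A0.
- move=> i; set E := enum_val i.
  have -> : B i = ~: (w @^-1: E) by apply/setP => c; rewrite !inE.
  (* Since [N] is even, [#|E|.*2 <= N.+1] sharpens to [#|E| <= n./2], which leaves at least
     [n.+1./2] points in [B i]. *)
  have leE : (#|w @^-1: E| <= n./2)%N.
    rewrite -(card_imset _ w_inj); apply: (@leq_trans #|E|).
      by apply/subset_leq_card/subsetP => _ /imsetP[c cE ->]; rewrite inE in cE.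
    by have := card_cycle_indep (indI i); rewrite -/E /N; lia.
  have := cardsC (w @^-1: E); rewrite card_ord.
  by move: (#|~: _|) (#|w @^-1: E|) leE => a b; lia.
Qed.

(** * Coordinate subalgebras and the Stanley decomposition *)

Section CoordinateRetracts.
Variables (K : fieldType) (n : nat).
Local Notation R := {mpoly K[n]}.
Implicit Types (B D : {set 'I_n}) (m : 'X_{1..n}).

Definition mnm_set m := [set i | m i != 0%N].

Lemma mnm_setD m1 m2 : mnm_set (m1 + m2)%MM = mnm_set m1 :|: mnm_set m2.
Proof. by apply/setP => i; rewrite !inE mnmDE addn_eq0 negb_and. Qed.

Lemma mnm_set_mesym1 B : mnm_set (mesym1 B) = B.
Proof. by apply/setP => i; rewrite inE mnmE; case: (i \in B). Qed.

Lemma mesym1_le B m : B \subset mnm_set m -> (mesym1 B <= m)%MM.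
Proof.
move=> /subsetP Bm; apply/mnm_lepP => i; rewrite mnmE.
by case: (boolP (i \in B)) => // /Bm; rewrite inE lt0n.
Qed.

Definition coord_proj B (p : R) : R := p \mPo [tuple if i \in B then 'X_i else 0 | i < n].

Definition coord_alg B (p : R) : Prop :=
  forall m, m \in msupp p -> mnm_set m \subset B.

Lemma coord_proj_endo B : kalg_endo (coord_proj B).
Proof.
split; rewrite /coord_proj.
- exact: comp_mpolyD.
- by move=> p q; rewrite rmorphM.
- exact: comp_mpoly1.
- by move=> c p; rewrite comp_mpolyZ.
Qed.

Lemma coord_projX B m :
  coord_proj B 'X_[m] = if mnm_set m \subset B then 'X_[m] else 0.
Proof.
rewrite /coord_proj comp_mpolyX; case: ifPn => [/subsetP mB|/subsetPn[i im iB]].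
  rewrite mpolyXE_id; apply: eq_bigr => i _; rewrite tnth_mktuple.
  case: ifPn => // iB; suff -> : m i = 0%N by rewrite !expr0.
  by apply/eqP; apply: contraNT iB => mi; apply: mB; rewrite inE.
rewrite (bigD1 i) //= tnth_mktuple (negPf iB) expr0n.
by move: im; rewrite inE => /negPf ->; rewrite mul0r.
Qed.

Lemma coord_projE B (p : R) :
  coord_proj B p = \sum_(m <- msupp p | mnm_set m \subset B) p@_m *: 'X_[m].
Proof.
rewrite (kalg_endoE (coord_proj_endo B)) [RHS]big_mkcond.
by apply: eq_bigr => m _; rewrite coord_projX; case: ifP; rewrite ?scaler0.
Qed.

Lemma msupp_coord_proj B (p : R) m :
  m \in msupp (coord_proj B p) -> (mnm_set m \subset B) && (m \in msupp p).
Proof.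
rewrite coord_projE => /msupp_sum_le /flattenP[_ /mapP[m' +] ->].
by rewrite mem_filter => m'P /msuppZ_le /mem_msuppXP <-.
Qed.

Lemma coord_alg_proj B (p : R) : coord_alg B (coord_proj B p).
Proof. by move=> m /msupp_coord_proj /andP[]. Qed.

Lemma coord_proj_id B (p : R) : coord_alg B p -> coord_proj B p = p.
Proof.
move=> Bp; rewrite coord_projE {3}(mpolyE p) -big_filter; congr (\sum_(m <- _) _).
by apply/all_filterP/allP => m; exact: Bp.
Qed.

Lemma coord_retract B : graded_retract (@homogn K n) (coord_alg B).
Proof.
exists (coord_proj B); split; first exact: coord_proj_endo.
- by move=> d p pd m /msupp_coord_proj /andP[_ /pd].
- exact: coord_alg_proj.
- exact: coord_proj_id.
Qed.

Lemma coord_proj_sub D B (p : R) :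
  D \subset B -> coord_proj D (coord_proj B p) = coord_proj D p.
Proof.
move=> DB; rewrite (kalg_endoE (coord_proj_endo B)).
have [_ _ _ projZ] := coord_proj_endo D.
rewrite (kalg_endo_sum (coord_proj_endo D)) [RHS](kalg_endoE (coord_proj_endo D)).
apply: eq_bigr => m _; rewrite projZ (coord_projX B); case: ifPn => // mB.
rewrite (kalg_endo0 (coord_proj_endo D)) coord_projX ifN //.
by apply: contra mB => /subset_trans; apply.
Qed.

(** The chain consists of the ideals generated by the first [j] variables of [B]. They are kernels
    of projections to polynomials in the remaining variables, a domain, hence prime. *)
Lemma coord_alg_dim_ge B q : (q <= #|B|)%N -> dim_ge (coord_alg B) q.
Proof.
move=> qB; pose D j := [set x in drop j (enum B)].
have DB j : D j \subset B.
  by apply/subsetP => x; rewrite inE => /mem_drop; rewrite mem_enum.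
have algM := retractM (coord_proj_endo B) (@coord_alg_proj B) (@coord_proj_id B).
have algD := retractD (coord_proj_endo B) (@coord_alg_proj B) (@coord_proj_id B).
have algC := retractC (coord_proj_endo B) (@coord_alg_proj B).
exists (fun j p => coord_alg B p /\ coord_proj (D j) p = 0); split.
  move=> j _; have [projD projM proj1 _] := coord_proj_endo (D j); split.
  - split; first by move=> p [].
    + by split; [rewrite -(mpolyC0 n K); exact: algC |
        exact: kalg_endo0 (coord_proj_endo _)].
    + by move=> p p' [Bp p0] [Bp' p'0]; split; [exact: algD | rewrite projD p0 p'0 addr0].
    + by move=> a p Ba [Bp p0]; split; [exact: algM | rewrite projM p0 mulr0].
  - by case=> _; rewrite proj1 => /eqP; rewrite oner_eq0.
  - move=> a b Ba Bb [_ /eqP]; rewrite projM mulf_eq0.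
    by case/orP => /eqP ab0; [left | right].
move=> j jq; have szB : (j < size (enum B))%N by rewrite -cardE (leq_trans jq).
have [b0 _] : exists b, b \in B.
  by apply/card_gt0P; rewrite (leq_trans _ qB) // (leq_trans _ jq).
have dropj := drop_nth b0 szB; set b := nth b0 (enum B) j in dropj.
have DS : D j.+1 \subset D j.
  by apply/subsetP => x; rewrite !inE dropj inE => ->; rewrite orbT.
split.
  move=> p [Bp p0]; split=> //.
  by rewrite -(coord_proj_sub _ DS) p0 (kalg_endo0 (coord_proj_endo _)).
have setU : mnm_set U_(b)%MM = [set b].
  by apply/setP => i; rewrite !inE mnm1E [i == b]eq_sym; case: (b == i).
have bDj : b \in D j by rewrite inE dropj mem_head.
have bND : b \notin D j.+1.
  by rewrite inE; have := drop_uniq j (enum_uniq B); rewrite dropj => /andP[].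
(* The variable dropped between [D j] and [D j.+1] makes the inclusion strict. *)
exists ('X_b : R); split.
  split; last by rewrite coord_projX setU sub1set (negPf bND).
  by move=> m /mem_msuppXP <-; rewrite setU sub1set (subsetP (DB j)).
case=> _; rewrite coord_projX setU sub1set bDj => /(congr1 (mcoeff U_(b)%MM)) /eqP.
by rewrite mcoeffX eqxx mcoeff0 oner_eq0.
Qed.

Lemma maxidealM (a p : R) : maxideal p -> maxideal (a * p).
Proof.
case=> c ->; exists (fun i => a * c i); rewrite mulr_sumr.
by apply: eq_bigr => i _; rewrite mulrA.
Qed.

Lemma maxideal_sum (I : Type) (r : seq I) (F : I -> R) :
  (forall i, maxideal (F i)) -> maxideal (\sum_(i <- r) F i).
Proof.
move=> MF; elim/big_rec: _ => [|i p _ [c ->]].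
  by exists (fun=> 0); rewrite big1 // => i _; rewrite mul0r.
have [d ->] := MF i; exists (fun i => d i + c i); rewrite -big_split.
by apply: eq_bigr => j _; rewrite mulrDl.
Qed.

Lemma maxidealX m : mnm_set m != set0 -> maxideal ('X_[m] : R).
Proof.
case/set0Pn => i; rewrite inE => mi.
rewrite -(@submK _ U_(i)%MM m) ?lep1mP // mpolyXD; apply: maxidealM.
exists (fun j => (j == i)%:R); rewrite (bigD1 i) //= eqxx mul1r big1 ?addr0 //.
by move=> j /negPf ->; rewrite mul0r.
Qed.

Lemma maxideal_msupp (p : R) m : maxideal p -> m \in msupp p -> mnm_set m != set0.
Proof.
move=> [c ->] mp; apply: contraTneq mp => m0.
have -> : m = 0%MM.
  apply/mnmP => i; rewrite mnm0E; apply/eqP; have := in_set0 i.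
  by rewrite -m0 inE => /negbFE.
rewrite -mcoeff_eq0 raddf_sum /= big1 // => j _.
by rewrite rmorphM /= mcoeffX mnm1_eq0 mulr0.
Qed.

(** Piece [i] has as basis the monomials with support between [A i] and [B i], and the maximal ideal
    is spanned by the monomials of nonempty support. [mesym1 (A i)] is the squarefree exponent with
    support [A i]. *)
Lemma stanley_dec_of_intervals k (A B : 'I_k -> {set 'I_n}) :
  (forall i, (A i != set0) && (A i \subset B i)) ->
  (forall C : {set 'I_n}, C != set0 -> exists i, (A i \subset C) && (C \subset B i)) ->
  (forall i j (C : {set 'I_n}), (A i \subset C) && (C \subset B i) ->
     (A j \subset C) && (C \subset B j) -> i = j) ->
  stanley_dec (@homogn K n) (@maxideal K n)
    (fun i => coord_alg (B i)) (fun i => 'X_[mesym1 (A i)]).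
Proof.
move=> AB cover uniqI; pose inI i m := (A i \subset mnm_set m) && (mnm_set m \subset B i).
have suppI i t m : coord_alg (B i) t -> m \in msupp (t * 'X_[mesym1 (A i)]) -> inI i m.
  have /andP[_ ABi] := AB i.
  move=> Bt /msuppM_le /allpairsP[[u v] /= [/Bt uB /mem_msuppXP <- ->]].
  by rewrite /inI mnm_setD mnm_set_mesym1 subsetUr subUset uB.
split.
- by move=> i; exact: coord_retract.
- move=> i; split; last by exists (fun j => (mesym1 (A i) j)%:Z); exact: homogXn.
  by apply: maxidealX; rewrite mnm_set_mesym1; case/andP: (AB i).
- move=> i s _ /eqP; rewrite mulf_eq0 => /orP[/eqP //|].
  by rewrite -msize_poly_eq0 msizeX.
- move=> p; split=> [Mp|[t [_ ->]]]; last first.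
    apply: maxideal_sum => i; apply/maxidealM/maxidealX.
    by rewrite mnm_set_mesym1; case/andP: (AB i).
  (* Component [i] collects the terms of [p] in piece [i], divided by its generator. *)
  exists [ffun i => \sum_(m <- msupp p | inI i m) p@_m *: 'X_[m - mesym1 (A i)]].
  split=> [i m|].
    rewrite ffunE => /msupp_sum_le /flattenP[_ /mapP[m' +] ->].
    rewrite mem_filter => /andP[/andP[_ m'B] _] /msuppZ_le /mem_msuppXP <-.
    apply: subset_trans m'B; apply/subsetP => j; rewrite !inE mnmBE.
    by apply: contraNneq => ->.
  transitivity (\sum_(m <- msupp p) \sum_(i | inI i m) p@_m *: 'X_[m]).
    rewrite {1}(mpolyE p); apply: eq_big_seq => m mp.
    have [i im] := cover _ (maxideal_msupp Mp mp).
    rewrite (big_pred1 i) // => j; apply/idP/eqP => [jm|-> //].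
    exact: uniqI jm im.
  rewrite (exchange_big_dep xpredT) //=; apply: eq_bigr => i _.
  rewrite ffunE mulr_suml; apply: eq_bigr => m /andP[Am _].
  by rewrite -scalerAl -mpolyXD submK // mesym1_le.
- move=> t Bt sum0 i; apply/mpolyP => m; rewrite mcoeff0.
  have [mi|mi] := boolP (inI i m); last first.
    by apply: memN_msupp_eq0; apply: contra mi; exact: suppI (Bt i).
  have := congr1 (mcoeff m) sum0; rewrite mcoeff0 raddf_sum (bigD1 i) //=.
  rewrite big1 ?addr0 // => j ji; apply: memN_msupp_eq0.
  apply: contra ji => /(suppI j (t j) m (Bt j)) mj.
  by apply/eqP; exact: uniqI mj mi.
Qed.

End CoordinateRetracts.

Theorem theorem3p1 (K : fieldType) (n : nat) : (0 < n)%N ->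
  is_Hdepth (@homog1 K n) (@sub1) (@maxideal K n) (n.+1)./2 /\
  is_Hdepth (@homogn K n) (@subn_deg n) (@maxideal K n) (n.+1)./2 /\
  is_Stdepth (@homogn K n) (@maxideal K n) (n.+1)./2.
Proof.
move=> n_gt0; have [k [A [B [AB cover uniqI cardB]]]] := interval_partition n.
(* This single decomposition realizes all three lower bounds. *)
have stB := stanley_dec_of_intervals K AB cover uniqI.
have dimB i := @coord_alg_dim_ge K n (B i) _ (cardB i).
have hilbn := stanley_dec_hilbert_dec (@homogn_0 K n) (@homognD K n) (@homognM K n).
split; [split | split; split].
- have [s hs] := stanley_dec_hilbert_dec (@homog1_0 K n) (@homog1D K n) (@homog1M K n)
    (stanley_decn1 stB).
  by exists k; exists (fun i => coord_alg (B i)); exists s.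
- move=> l S s /(hilbert_dec1_upper_bound n_gt0); exact: not_all_ex_not.
- have [s hs] := hilbn _ _ _ _ stB.
  by exists k; exists (fun i => coord_alg (B i)); exists s.
- move=> l S s /(hilbert_decn_upper_bound n_gt0); exact: not_all_ex_not.
- by exists k; do 2!eexists; split; first exact: stB.
(* A Stanley decomposition yields a Hilbert decomposition with the same retracts, so the upper bound
   carries over. *)
- move=> l S x /hilbn[s /(hilbert_decn_upper_bound n_gt0)]; exact: not_all_ex_not.
Qed.
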